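(* Let $a,b$ be positive integers with $a/b\ge 2$. Let $(p_n)_{n}$ and $(q_n)_{n}$ be sequences of positive integers such that $p_n/q_n$ converges to $a/b$ from above (that is, $p_n/q_n\ge a/b$ for all $n$ and $p_n/q_n\to a/b$). Then the sequence of fraction graphs $E_{p_n/q_n}$ converges to the fraction graph $E_{a/b}$ in the asymptotic spectrum distance.
   Context: Graphs here are finite and simple. $E_n$ denotes the graph with $n$ vertices and no edges, $G\sqcup H$ the disjoint union, and $G\boxtimes H$ the strong product: its vertex set is $V(G)\times V(H)$, and distinct $(a,x),(b,y)$ are adjacent iff ($a=b$ or $\{a,b\}\in E(G)$) and ($x=y$ or $\{x,y\}\in E(H)$). A cohomomorphism $G\to H$ is a map $f:V(G)\to V(H)$ such that for all distinct non-adjacent $u,v\in V(G)$ the vertices $f(u),f(v)$ are distinct and non-adjacent in $H$. Write $G\le H$ if there is a cohomomorphism $G\to H$. The asymptotic spectrum of graphs $\mathcal X$ is the set of all maps $F$ from finite graphs to $\mathbb R_{\ge 0}$ with $F(G\sqcup H)=F(G)+F(H)$, $F(G\boxtimes H)=F(G)F(H)$, $F(E_n)=n$ for all $n\in\mathbb N$, and $G\le H\Rightarrow F(G)\le F(H)$. The asymptotic spectrum distance is $d(G,H)=\sup_{F\in\mathcal X}|F(G)-F(H)|$. A sequence of graphs $G_i$ converges to $H$ if $d(G_i,H)\to 0$. For positive integers $p,q$ with $p/q\ge 2$, the fraction graph $E_{p/q}$ has vertex set $\{0,\dots,p-1\}$, and distinct $u,v$ are adjacent iff $u-v \bmod p<q$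 or $v-u\bmod p<q$. *)

(* Defs.v *)
From HB Require Import structures.
From mathcomp Require Import all_boot all_order all_algebra.
From mathcomp Require Import all_classical all_reals all_analysis.

Set Implicit Arguments.
Unset Strict Implicit.
Unset Printing Implicit Defensive.

Import Order.TTheory GRing.Theory Num.Theory.
Import numFieldNormedType.Exports.

Local Open Scope classical_set_scope.
Local Open Scope ring_scope.

Record graph := Graph {
  vertex :> finType;
  adj : rel vertex;
  adj_sym : symmetric adj;
  adj_irr : irreflexive adj }.

Section GraphOperations.

Definition edgeless_adj (n : nat) : rel 'I_n := fun _ _ => false.

Lemma edgeless_sym n : symmetric (@edgeless_adj n).
Proof. by []. Qed.

Lemma edgeless_irr n : irreflexive (@edgeless_adj n).
Proof. by []. Qed.

Definition edgeless (n : nat) : graph :=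
  Graph (@edgeless_sym n) (@edgeless_irr n).

Variables G H : graph.

Definition disjoint_union_adj : rel (G + H)%type := fun u v =>
  match u, v with
  | inl a, inl b => adj a b
  | inr x, inr y => adj x y
  | _, _ => false
  end.

Lemma disjoint_union_sym : symmetric disjoint_union_adj.
Proof. by move=> [a|x] [b|y] //=; apply: adj_sym. Qed.

Lemma disjoint_union_irr : irreflexive disjoint_union_adj.
Proof. by move=> [a|x] /=; apply: adj_irr. Qed.

Definition disjoint_union : graph :=
  Graph disjoint_union_sym disjoint_union_irr.

Definition strong_product_adj : rel (G * H)%type := fun u v =>
  [&& u != v, (u.1 == v.1) || adj u.1 v.1 & (u.2 == v.2) || adj u.2 v.2].

Lemma strong_product_sym : symmetric strong_product_adj.
Proof.
move=> u v; rewrite /strong_product_adj eq_sym (eq_sym u.1) (eq_sym u.2).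
by rewrite (adj_sym u.1) (adj_sym u.2).
Qed.

Lemma strong_product_irr : irreflexive strong_product_adj.
Proof. by move=> u; rewrite /strong_product_adj eqxx. Qed.

Definition strong_product : graph :=
  Graph strong_product_sym strong_product_irr.

Definition cohomomorphism (f : G -> H) : Prop :=
  forall u v : G, u != v -> ~~ adj u v -> f u != f v /\ ~~ adj (f u) (f v).

Definition cohom_le : Prop := exists f : G -> H, cohomomorphism f.

End GraphOperations.

(* [%%] on [int] takes values in [0, p), so differences are reduced as
   integers rather than with the truncated subtraction of [nat]. *)
Definition fraction_adj (p q : nat) : rel 'I_p := fun u v =>
  (u != v) &&
  (((((u : nat)%:Z - (v : nat)%:Z) %% p%:Z)%Z < q%:Z)
   || ((((v : nat)%:Z - (u : nat)%:Z) %% p%:Z)%Z < q%:Z)).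

Lemma fraction_sym p q : symmetric (@fraction_adj p q).
Proof. by move=> u v; rewrite /fraction_adj eq_sym orbC. Qed.

Lemma fraction_irr p q : irreflexive (@fraction_adj p q).
Proof. by move=> u; rewrite /fraction_adj eqxx. Qed.

Definition fraction_graph (p q : nat) : graph :=
  Graph (@fraction_sym p q) (@fraction_irr p q).

Section AsymptoticSpectrum.
Variable R : realType.

(* A plain predicate: [set (graph -> R)] is a universe inconsistency. *)
Definition asymptotic_spectrum (F : graph -> R) : Prop :=
  [/\ forall G, 0 <= F G,
      forall G H, F (disjoint_union G H) = F G + F H,
      forall G H, F (strong_product G H) = F G * F H,
      forall n, F (edgeless n) = n%:R
    & forall G H, cohom_le G H -> F G <= F H].

Definition asymptotic_distance (G H : graph) : R :=
  sup [set x : R | exists2 F, asymptotic_spectrum F & x = `|F G - F H|].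

(* The supremum is taken over a bounded set, so it is never the default
   value that [sup] assigns to unbounded sets. *)
Lemma asymptotic_spectrum_le_card F G :
  asymptotic_spectrum F -> F G <= #|G|%:R.
Proof.
move=> [_ _ _ FE Fle]; rewrite -FE; apply: Fle.
by exists enum_rank => u v uv _; split; rewrite // (inj_eq enum_rank_inj).
Qed.

Lemma asymptotic_distance_has_ubound G H :
  has_ubound [set x : R | exists2 F, asymptotic_spectrum F & x = `|F G - F H|].
Proof.
exists (#|G|%:R + #|H|%:R) => _ [F XF ->].
have [F0 _ _ _ _] := XF.
rewrite (le_trans (ler_normB _ _))// !ger0_norm//.
by rewrite lerD// asymptotic_spectrum_le_card.
Qed.

Definition graph_converges (G : nat -> graph) (H : graph) : Prop :=
  asymptotic_distance (G n) H @[n --> \oo] --> (0 : R).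

End AsymptoticSpectrum.

(* Main.v *)
Require Import Defs.
From mathcomp Require Import all_boot all_order all_algebra.
From mathcomp Require Import all_classical all_reals all_analysis.
From mathcomp Require Import zify ring lra.

(** Write [s = b * p / q - a] for the excess of [p / q] over [a / b], scaled by
    [b]; it is nonnegative and tends to [0].  The graph [E_(p/q)] lives on a
    cycle of length [p], and the distinct non-adjacent pairs are those at
    cyclic distance at least [q].  Scaling by [b / q] and rounding down,
    [u |-> (u * b + c) %/ q], turns a distance of at least [q] into one of at
    least [b], but it wraps the cycle of length [p] around one of length
    [a + s] instead of [a].  Hence it respects non-adjacency in [E_(a/b)] at
    all vertices [u] where [u] and [u + p] have images at most [a] apart, and
    it fails only where a rounding threshold falls inside the overhang [s].
    When [s <= 0] there is no failure, which is the monotonicity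
    [E_(p/q) <= E_(a/b)] for [p / q <= a / b] ([fraction_graph_le]).  When
    [s > 0], let the offset [c] range over the [q] residues: each vertex is
    good for at least [q - q * s] of them ([fraction_graph_cover]).

    So [E_(p/q)] is covered, each vertex at least a fraction [1 - s] of the time, by
    pieces that map to [E_(a/b)].  Such a fractional cover of [G] by pieces
    mapping to [H], with density [d], forces [F G * d <= F H] for every point
    [F] of the asymptotic spectrum ([spectrum_fractionally_covered]).  Indeed
    the [n]-th strong power of [G] has a fractional cover of density [d ^ n] by
    pieces mapping to the [n]-th power of [H], and by random choice a number of
    pieces of order [n / d ^ n] already covers every vertex.  Sending each
    vertex to the piece that contains it, in disjoint copies of the target,
    gives [F G ^ n <= O (n / d ^ n) * F H ^ n]; the linear factor disappears
    when the [n]-th root is taken.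

    With [F (E_(a/b)) <= a] this gives, uniformly in [F] and as soon as
    [s <= 1 / 2],
    [0 <= F (E_(p/q)) - F (E_(a/b)) <= s * F (E_(p/q)) <= 2 * a * s].  *)

Import Order.TTheory GRing.Theory Num.Theory.
Import numFieldNormedType.Exports.

Local Open Scope classical_set_scope.
Local Open Scope ring_scope.

Set Implicit Arguments.
Unset Strict Implicit.
Unset Printing Implicit Defensive.

(** * Fractional covers by partial cohomomorphisms *)

Definition partial_cohom {G H : graph} (S : pred G) (f : G -> H) : Prop :=
  forall u v, S u -> S v -> u != v -> ~~ adj u v ->
    f u != f v /\ ~~ adj (f u) (f v).

(** A cover of [G] by [N] pieces mapping to [H] that covers each vertex at least
    [k] times.  The index type is kept abstract because covers of a strong
    product are indexed by pairs.  *)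
Definition fractionally_covered (G H : graph) (N k : nat) : Prop :=
  exists (I : finType) (S : I -> pred G) (f : I -> G -> H),
    [/\ #|I| = N, forall i, partial_cohom (S i) (f i)
      & forall u, (k <= #|[pred i | S i u]|)%N].

(** Two vertices of a strong product are distinct and non-adjacent exactly when
    they are so in one of the coordinates, hence a coordinatewise map is
    controlled by whichever coordinate separates them.  *)
Lemma partial_cohom_prod (G G' H H' : graph) (S : pred G) (S' : pred G')
    (f : G -> H) (f' : G' -> H') :
  partial_cohom S f -> partial_cohom S' f' ->
  @partial_cohom (strong_product G G') (strong_product H H')
    (fun u => S u.1 && S' u.2) (fun u => (f u.1, f' u.2)).
Proof.
move=> cf cf' [u u'] [v v'] /= /andP[Su Su'] /andP[Sv Sv'] uv.
rewrite /adj/= /strong_product_adj/= uv/= xpair_eqE !negb_and !negb_or.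
case/orP=> /andP[neq nadj].
  by have [-> ->] := cf u v Su Sv neq nadj; rewrite !orbT.
by have [-> ->] := cf' u' v' Su' Sv' neq nadj; rewrite !orbT.
Qed.

Lemma fractionally_covered_prod (G G' H H' : graph) (N k N' k' : nat) :
  fractionally_covered G H N k -> fractionally_covered G' H' N' k' ->
  fractionally_covered (strong_product G G') (strong_product H H')
    (N * N') (k * k').
Proof.
move=> [I [S [f [cI cf ck]]]] [I' [S' [f' [cI' cf' ck']]]].
exists (I * I')%type, (fun i u => S i.1 u.1 && S' i.2 u.2).
exists (fun i u => (f i.1 u.1, f' i.2 u.2)); split.
- by rewrite card_prod cI cI'.
- by move=> [i i']; apply: partial_cohom_prod.
- move=> [u u']; apply: leq_trans (leq_mul (ck u) (ck' u')) _.
  by rewrite -cardX subset_leq_card.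
Qed.

Fixpoint strong_power (G : graph) (n : nat) : graph :=
  if n is n'.+1 then strong_product G (strong_power G n') else edgeless 1.

Lemma card_strong_power (G : graph) n : #|strong_power G n| = (#|G| ^ n)%N.
Proof. by elim: n => [|n IHn]; rewrite ?card_ord// card_prod IHn expnS. Qed.

Lemma fractionally_covered_power (G H : graph) (N k n : nat) :
  fractionally_covered G H N k ->
  fractionally_covered (strong_power G n) (strong_power H n) (N ^ n) (k ^ n).
Proof.
move=> GH; elim: n => [|n IHn]; last first.
  by rewrite !expnS; apply: fractionally_covered_prod.
exists unit, (fun _ _ => true), (fun _ => id); split=> //.
  by rewrite card_unit.
by move=> u; rewrite expn0 (eq_card (B := predT)) ?card_unit.
Qed.

(** Random covering.  A random [t]-tuple of pieces misses a given vertex with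
    probability at most [(1 - k / N) ^ t], so by the union bound some tuple
    misses none.  Mapping each vertex through one of the pieces that contain
    it, into the copy of [H] attached to the position of that piece, is a
    cohomomorphism: vertices sent to distinct copies become non-adjacent, and
    within a copy the partial cohomomorphism applies.  *)
Lemma cohom_le_of_cover (G H : graph) (N k t : nat) :
  fractionally_covered G H N k -> (#|G| * (N - k) ^ t < N ^ t)%N ->
  cohom_le G (strong_product (edgeless t) H).
Proof.
move=> [I [S [f [cI cf ck]]]] small.
pose miss u : pred {ffun 'I_t -> I} := fun g => [forall j, ~~ S (g j) u].
have card_miss u : (#|miss u| <= (N - k) ^ t)%N.
  have -> : #|miss u| = (#|[predC [pred i | S i u]]| ^ #|'I_t|)%N.
    rewrite -card_ffun_on; apply: eq_card => g.
    by rewrite [LHS]unfold_in; apply/forallP/ffun_onP => gP j; have := gP j.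
  rewrite card_ord; have [->//|t0] := posnP t; rewrite leq_exp2r//.
  rewrite leq_subRL; last by rewrite -cI (leq_trans (ck u)) ?max_card.
  by rewrite -cI -(cardC [pred i | S i u]) leq_add2r ck.
have [g gP] : exists g : {ffun 'I_t -> I}, [forall u, ~~ miss u g].
  apply/existsP; apply: contraTT small.
  rewrite -leqNgt negb_exists => /forallP all_miss.
  (* Double counting of the pairs of a tuple and a vertex it misses. *)
  have -> : (N ^ t)%N = \sum_(g : {ffun 'I_t -> I}) 1.
    by rewrite sum1_card card_ffun card_ord cI.
  apply: (@leq_trans (\sum_(g : {ffun 'I_t -> I}) \sum_(u : G) miss u g)).
    apply: leq_sum => g _; have := all_miss g; rewrite negb_forall.
    by case/existsP=> u; rewrite negbK => gu; rewrite (bigD1 u)//= gu.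
  have -> : (#|G| * (N - k) ^ t = \sum_(u : G) (N - k) ^ t)%N.
    by rewrite sum_nat_const.
  rewrite exchange_big/=; apply: leq_sum => u _.
  apply: leq_trans (card_miss u); rewrite -sum1_card [leqRHS]big_mkcond/=.
  apply: leq_sum => g _; have -> : (g \in miss u) = miss u g by [].
  by case: (miss u g).
have hit u : exists j, S (g j) u.
  have := forallP gP u; rewrite negb_forall => /existsP[j].
  by rewrite negbK; exists j.
pose sel u := xchoose (hit u).
exists (fun u => (sel u, f (g (sel u)) u)) => u v uv nadj.
suff : ~~ ((sel u == sel v) && ((f (g (sel u)) u == f (g (sel v)) v)
                             || adj (f (g (sel u)) u) (f (g (sel v)) v))).
  rewrite [@adj (strong_product _ _) _ _]/= /strong_product_adj/= xpair_eqE orbF.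
  case: (sel u == sel v) => //=.
  by rewrite negb_or => /andP[/negbTE-> /negbTE->].
apply/negP => /andP[/eqP eq_sel].
have Su := xchooseP (hit u); have Sv := xchooseP (hit v).
rewrite -/(sel u) -/(sel v) -eq_sel in Su Sv *.
have [fuv nfuv] := cf (g (sel u)) u v Su Sv uv nadj.
by rewrite (negbTE fuv) (negbTE nfuv).
Qed.

(** * Fractional covers and the asymptotic spectrum *)

(** An exponential with ratio [1 + d > 1] outgrows any affine function.
    Bernoulli's inequality alone gives only linear growth, so it is used on
    half of the exponent and squared.  *)
Lemma exp_dominates_affine (R : realType) (x y c : R) :
  0 <= x -> 0 <= y -> 0 <= c ->
  (forall n, (0 < n)%N -> x ^+ n <= (n%:R * c + 1) * y ^+ n) -> x <= y.
Proof.
move=> x0 y0 c0 xy; rewrite leNgt; apply/negP => ltyx.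
have ypos : 0 < y.
  rewrite lt_neqAle y0 andbT eq_sym; apply/eqP => yE.
  by have := xy 1%N isT; rewrite !expr1; nra.
pose d := x / y - 1.
have d0 : 0 < d by rewrite subr_gt0 ltr_pdivlMr// mul1r.
have bern n : 1 + n%:R * d <= (1 + d) ^+ n.
  elim: n => [|n IHn]; first by rewrite expr0 mul0r addr0.
  rewrite exprS -natr1; have := ler_wpM2l (_ : 0 <= 1 + d) IHn.
  have n0 : 0 <= n%:R :> R by [].
  by move=> /(_ ltac:(lra)); apply: le_trans; nra.
have dn n : (0 < n)%N -> (1 + d) ^+ n <= n%:R * c + 1.
  move=> n0; rewrite /d addrC subrK expr_div_n ler_pdivrMr ?exprn_gt0//.
  exact: xy.
(* Exponent [2 * n] would give [n ^+ 2 * d ^+ 2 <= 2 * n * c + 1], which is at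
   most [n * (2 * c + 1)]; this [n] is chosen to make that false. *)
pose n := (Num.truncn ((2 * c + 1) / d ^+ 2)).+1.
have := truncnS_gt ((2 * c + 1) / d ^+ 2); rewrite -/n => nP.
rewrite ltr_pdivrMr ?exprn_gt0// in nP.
have n1 : 1 <= n%:R :> R by rewrite ler1n.
have := dn (n * 2)%N isT; rewrite exprM natrM.
have := bern n; set z := (1 + d) ^+ n => zP zle.
have : (n%:R * d) ^+ 2 <= z ^+ 2.
  by rewrite lerXn2r ?nnegrE; nra.
by nra.
Qed.

Lemma spectrum_strong_power (R : realType) (F : graph -> R) (G : graph) n :
  asymptotic_spectrum F -> F (strong_power G n) = F G ^+ n.
Proof.
move=> [_ _ FM FE _].
by elim: n => [|n IHn]; rewrite ?FE// FM IHn exprS.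
Qed.

(** By [1 - x <= exp (- x)], any [t > L / x] makes [m * (1 - x) ^ t] smaller than
    [m * exp (- L)]; the least such [t] overshoots [L / x] by at most one.  *)
Lemma covering_time (R : realType) (m : nat) (x L : R) :
  0 < x -> x <= 1 -> 0 <= L -> m%:R < expR L ->
  exists t, m%:R * (1 - x) ^+ t < 1 /\ t%:R * x <= L + 1.
Proof.
move=> x0 x1 L0 mL; pose t := (Num.truncn (L / x)).+1.
have Lt : L < t%:R * x by rewrite -ltr_pdivrMr// truncnS_gt.
exists t; split; last first.
  rewrite /t -natr1 mulrDl mul1r lerD// -ler_pdivlMr//.
  by rewrite truncn_le// divr_ge0// ltW.
have decay : (1 - x) ^+ t <= expR (- L).
  apply: (@le_trans _ _ (expR (- x) ^+ t)).
    by rewrite lerXn2r ?nnegrE ?subr_ge0 ?expR_ge0// expR_ge1Dx.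
  by rewrite -expRM_natl ler_expR mulrN lerN2 ltW.
apply: (@le_lt_trans _ _ (m%:R * expR (- L))); first by rewrite ler_wpM2l.
by rewrite expRN ltr_pdivrMr ?expR_gt0// mul1r.
Qed.

(** A fractional cover of density [d = k / N] costs a point of the spectrum a
    factor [d] and no more.  The random covering of [G] itself loses a
    logarithm of its size; for the [n]-th power this loss is linear in [n], and
    it vanishes on taking [n]-th roots.  *)
Lemma spectrum_fractionally_covered (R : realType) (F : graph -> R)
    (G H : graph) (N k : nat) :
  asymptotic_spectrum F -> (0 < k <= N)%N -> fractionally_covered G H N k ->
  F G * k%:R <= F H * N%:R.
Proof.
move=> XF /andP[k0 kN] GH; have [F0 _ FM FE Fle] := XF.
have N0 : 0 < N%:R :> R by rewrite ltr0n (leq_trans k0).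
rewrite -ler_pdivrMr// -mulrA; set d := k%:R / N%:R.
have d0 : 0 < d by rewrite divr_gt0// ltr0n.
have d1 : d <= 1 by rewrite ler_pdivrMr// mul1r ler_nat.
apply: (@exp_dominates_affine _ _ _ #|G|%:R) => //.
  by rewrite mulr_ge0// ltW.
move=> n n0.
(* [#|G|] serves as a convenient upper bound for its own logarithm. *)
have small : (#|G| ^ n)%:R < expR (n%:R * #|G|%:R) :> R.
  rewrite natrX expRM_natl ltrXn2r -?lt0n//.
  by apply: lt_le_trans (expR_ge1Dx _); rewrite ltrDr.
have [t [few tle]] : exists t,
    (#|G| ^ n)%:R * (1 - d ^+ n) ^+ t < 1 /\
    t%:R * d ^+ n <= n%:R * #|G|%:R + 1.
  by apply: covering_time small; rewrite ?exprn_gt0 ?exprn_ile1 ?mulr_ge0// ltW.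
have knN : (k ^ n <= N ^ n)%N by case: (n) => // n'; rewrite leq_exp2r.
have cov : F G ^+ n <= t%:R * F H ^+ n.
  rewrite -!spectrum_strong_power// -FE -FM; apply: Fle.
  apply: (cohom_le_of_cover (fractionally_covered_power n GH)).
  rewrite card_strong_power -(ltr_nat R) natrM !natrX natrB// !natrX.
  rewrite -[ltRHS]mul1r -ltr_pdivrMr ?exprn_gt0// -mulrA -expr_div_n.
  by rewrite mulrBl divff ?expf_neq0 ?gt_eqF// -expr_div_n -natrX.
rewrite exprMn; apply: (@le_trans _ _ (t%:R * F H ^+ n * d ^+ n)).
  by rewrite ler_wpM2r// exprn_ge0// ltW.
by rewrite mulrAC ler_wpM2r// exprn_ge0.
Qed.

(** * Rounding maps between fraction graphs *)

Lemma fraction_nonadj (p q : nat) (u v : fraction_graph p q) :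
  u != v -> ~~ adj u v ->
  ((u + q <= v) && (v + q <= u + p) || (v + q <= u) && (u + q <= v + p))%N.
Proof.
rewrite {1}/adj/= /fraction_adj => uv; rewrite uv/= negb_or -!leNgt.
wlog lt_uv : u v uv / (u < v)%N => [th|].
  have := uv; rewrite -val_eqE neq_ltn => /orP[/th|/th vu]; first exact.
  by rewrite andbC orbC; apply: vu; rewrite eq_sym.
have vp := ltn_ord v.
have -> : (((u : nat)%:Z - (v : nat)%:Z) %% p%:Z)%Z
    = (u : nat)%:Z - (v : nat)%:Z + p%:Z.
  by rewrite -modzDr modz_small; lia.
by rewrite modz_small; lia.
Qed.

Lemma fraction_nonadj_mod (a b x y : nat) (a_gt0 : (0 < a)%N) :
  (0 < b)%N -> (x + b <= y)%N -> (y + b <= x + a)%N ->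
  let u : fraction_graph a b := Ordinal (ltn_pmod x a_gt0) in
  let v : fraction_graph a b := Ordinal (ltn_pmod y a_gt0) in
  u != v /\ ~~ adj u v.
Proof.
move=> b0 xy yx u v.
have diff_mod z w : ((((z %% a)%N : int) - ((w %% a)%N : int)) %% (a : int))%Z
    = ((z%:Z - w%:Z) %% a%:Z)%Z.
  rewrite [in RHS](divn_eq z a) [in RHS](divn_eq w a) !PoszD !PoszM.
  rewrite -[RHS](modzMDl ((w %/ a)%N%:Z - (z %/ a)%N%:Z)).
  by congr (_ %% _)%Z; ring.
have uv : (((v : nat)%:Z - (u : nat)%:Z) %% a%:Z)%Z = y%:Z - x%:Z.
  by rewrite diff_mod modz_small; lia.
have vu : (((u : nat)%:Z - (v : nat)%:Z) %% a%:Z)%Z = x%:Z - y%:Z + a%:Z.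
  by rewrite diff_mod -modzDr modz_small; lia.
split; last by rewrite /adj/= /fraction_adj uv vu; lia.
by apply/eqP => e; move: uv; rewrite e subrr mod0z; lia.
Qed.

Definition rounding (p q a b c : nat) (a_gt0 : (0 < a)%N)
    (u : fraction_graph p q) : fraction_graph a b :=
  Ordinal (ltn_pmod ((u * b + c) %/ q) a_gt0).

(** Write [g w = (w * b + c) %/ q], so that [g (w + q) = g w + b].  If [u < v] are
    non-adjacent then [u + q <= v] and [v + q <= u + p], and monotonicity of
    [g] gives [g u + b <= g v] and [g v + b <= g (u + p)].  The condition
    [g (u + p) <= g u + a] then closes the cycle: [g v + b <= g u + a].  *)
Lemma rounding_partial_cohom (p q a b c : nat) (a_gt0 : (0 < a)%N) :
  (0 < q)%N -> (0 < b)%N ->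
  partial_cohom (fun u : fraction_graph p q =>
      ((u + p) * b + c) %/ q <= (u * b + c) %/ q + a)%N
    (@rounding p q a b c a_gt0).
Proof.
move=> q0 b0 u v; wlog lt_uv : u v / (u + q <= v)%N && (v + q <= u + p)%N.
  move=> th Su Sv uv nadj; have := fraction_nonadj uv nadj.
  case/orP=> [/th|/th vu]; first exact.
  rewrite eq_sym adj_sym; apply: vu => //; first by rewrite eq_sym.
  by rewrite adj_sym.
case/andP: lt_uv => uv vu Su _ _ _.
have shift w : (((w + q) * b + c) %/ q = (w * b + c) %/ q + b)%N.
  by rewrite mulnDl addnAC (mulnC q) divnDMl.
apply: fraction_nonadj_mod => //; rewrite -shift.
  by rewrite leq_div2r// leq_add2r leq_mul2r uv orbT.
by apply: leq_trans Su; rewrite leq_div2r// leq_add2r leq_mul2r vu orbT.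
Qed.

Lemma fraction_graph_le (p q a b : nat) :
  (0 < q)%N -> (0 < a)%N -> (0 < b)%N -> (p * b <= a * q)%N ->
  cohom_le (fraction_graph p q) (fraction_graph a b).
Proof.
move=> q0 a0 b0 pbaq.
exists (rounding b 0 a0) => u v uv nadj.
apply: rounding_partial_cohom => //=.
  by rewrite -divnDMl// leq_div2r// mulnDl; lia.
by rewrite -divnDMl// leq_div2r// mulnDl; lia.
Qed.

(** With [r = p * b - a * q], the rounding map with offset [c] is good at [u] as
    soon as [(u * b + c) %% q < q - r]: adding [r] then does not cross a multiple
    of [q].  For fixed [u] that residue is a bijective function of [c], so this
    holds for [q - r] of the offsets.  *)
Lemma fraction_graph_cover (p q a b : nat) :
  (0 < q)%N -> (0 < a)%N -> (0 < b)%N ->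
  fractionally_covered (fraction_graph p q) (fraction_graph a b)
    q (q - (p * b - a * q)).
Proof.
move=> q0 a0 b0; set r := (p * b - a * q)%N.
exists 'I_q, (fun (c : 'I_q) (u : fraction_graph p q) =>
  ((u + p) * b + c) %/ q <= (u * b + c) %/ q + a)%N.
exists (fun c : 'I_q => rounding b c a0).
split; [exact: card_ord | by move=> c; apply: rounding_partial_cohom |].
move=> u.
pose rot (c : 'I_q) : 'I_q := Ordinal (ltn_pmod (u * b + c) q0).
have rot_inj : injective rot.
  move=> c d /(congr1 val)/= /eqP; rewrite eqn_modDl !modn_small// => /eqP.
  exact: val_inj.
have -> : (q - r)%N = #|[set c : 'I_q | c < q - r]%N%SET|.
  rewrite -sum1_card (eq_bigl (fun c : 'I_q => c < q - r)%N); last first.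
    by move=> c; rewrite inE.
  rewrite -(big_ord_widen_cond q predT (fun _ => 1%N)) ?leq_subr//.
  by rewrite sum1_card card_ord.
rewrite -(card_preimset _ rot_inj); apply: subset_leq_card.
apply/fintype.subsetP => c; rewrite !inE/= => small.
rewrite mulnDl addnAC -ltnS ltn_divLR// [X in (X + p * b)%N](divn_eq _ q).
have : (p * b <= a * q + r)%N by rewrite /r; lia.
by rewrite mulSn mulnDl; move: small; lia.
Qed.

(** * Convergence *)

(** With [x] and [y] the values at [E_(p/q)] and [E_(a/b)], the fractional cover
    gives [x * (1 - s) <= y <= a].  For [s <= 1 / 2] this bounds [x] by [2 * a],
    and then [x - y <= x * s <= 2 * a * s].  *)
Lemma fraction_graph_dist_le (R : realType) (F : graph -> R) (p q a b : nat) :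
  asymptotic_spectrum F -> (0 < a)%N -> (0 < b)%N -> (0 < q)%N ->
  let s := p%:R / q%:R * b%:R - a%:R in
  0 <= s -> s <= 2^-1 ->
  `|F (fraction_graph p q) - F (fraction_graph a b)| <= 2 * a%:R * s.
Proof.
move=> XF a0 b0 q0 s s0 s2; have [F0 _ _ _ Fle] := XF.
have q0R : 0 < q%:R :> R by rewrite ltr0n.
have sq : s * q%:R = p%:R * b%:R - a%:R * q%:R.
  by rewrite mulrBl mulrAC divfK ?gt_eqF.
have aqpb : (a * q <= p * b)%N.
  by rewrite -(ler_nat R) !natrM -subr_ge0 -sq mulr_ge0// ltW.
have rE : (p * b - a * q)%:R = s * q%:R :> R by rewrite natrB// !natrM sq.
have rq : (p * b - a * q < q)%N by rewrite -(ltr_nat R) rE; nra.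
have lower : F (fraction_graph a b) <= F (fraction_graph p q).
  apply: Fle; apply: fraction_graph_le => //.
  by rewrite lt0n; apply: contraTneq aqpb => ->; rewrite -ltnNge muln_gt0 a0.
have := spectrum_fractionally_covered XF _ (fraction_graph_cover p q0 a0 b0).
rewrite subn_gt0 leq_subr rq natrB ?(ltnW rq)// rE => /(_ isT) upper.
have Fa : F (fraction_graph a b) <= a%:R.
  have := asymptotic_spectrum_le_card (fraction_graph a b) XF.
  by rewrite card_ord.
rewrite ger0_norm ?subr_ge0//.
move: lower upper Fa (F0 (fraction_graph a b)).
set x := F (fraction_graph p q); set y := F (fraction_graph a b).
move=> lower upper Fa y0.
have {}upper : x * (1 - s) <= y.
  rewrite -(ler_pM2r q0R); apply: le_trans upper.
  by rewrite -mulrA mulrBl mul1r.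
have xa : x <= 2 * a%:R by nra.
by nra.
Qed.

Lemma asymptotic_distance_itv (R : realType) (G H : graph) (e : R) :
  0 <= e -> (forall F, asymptotic_spectrum F -> `|F G - F H| <= e) ->
  0 <= asymptotic_distance R G H <= e.
Proof.
move=> e0 dist_le; rewrite /asymptotic_distance.
have ubD := asymptotic_distance_has_ubound R G H.
set D := [set x : R | _] in ubD *.
(* [sup] of the empty set is [0]: the bounds hold even for an empty spectrum. *)
have [->|/set0P[x Dx]] := eqVneq D classical_sets.set0.
  by rewrite sup0 lexx.
apply/andP; split; last first.
  by apply: ge_sup; [exists x | move=> _ [F XF ->]; exact: dist_le].
by apply: le_trans (ub_le_sup ubD Dx); case: Dx => F _ ->.
Qed.

Unset Implicit Arguments.

Theorem theorem1p1 (R : realType) (a b : nat) (p q : nat -> nat)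
    (a_gt0 : (0 < a)%N) (b_gt0 : (0 < b)%N)
    (ab_ge2 : 2 <= a%:R / b%:R :> R)
    (p_gt0 : forall n, (0 < p n)%N) (q_gt0 : forall n, (0 < q n)%N)
    (pq_ge : forall n, a%:R / b%:R <= (p n)%:R / (q n)%:R :> R)
    (pq_cvg : (p n)%:R / (q n)%:R @[n --> \oo] --> (a%:R / b%:R : R)) :
  graph_converges R (fun n => fraction_graph (p n) (q n)) (fraction_graph a b).
Proof.
have b0R : 0 < b%:R :> R by rewrite ltr0n.
pose s n : R := (p n)%:R / (q n)%:R * b%:R - a%:R.
have s_ge0 n : 0 <= s n by rewrite subr_ge0 -ler_pdivrMr.
have s_cvg : s n @[n --> \oo] --> (0 : R).
  have -> : 0 = a%:R / b%:R * b%:R - a%:R :> R by rewrite divfK ?gt_eqF// subrr.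
  by apply: cvgB; [apply: cvgMl | exact: cvg_cst].
have s_small : \forall n \near \oo, s n <= 2^-1.
  by apply: (cvgr_le 0 s_cvg); rewrite invr_gt0.
apply: (@squeeze_cvgr _ _ _ _ (fun=> 0) (fun n => 2 * a%:R * s n)).
- near=> n; apply: asymptotic_distance_itv => [|F XF].
    by rewrite mulr_ge0.
  apply: fraction_graph_dist_le => //; first exact: s_ge0.
  rewrite -/(s n); near: n; exact: s_small.
- exact: cvg_cst.
- by rewrite -[X in _ --> X](mulr0 (2 * a%:R)); apply: cvgMr.
Unshelve. all: by end_near. Qed.
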